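(* Let $\mathcal{K}$ be an essentially small tensor triangulated category and let $\Phi \subset \mathcal{K}$ be a non-empty set of objects closed under the $\otimes$-product. Let $\mathcal{Z}_\Phi := \bigcap_{X \in \Phi} \operatorname{supp}(X) \subset \operatorname{Spc}(\mathcal{K})$. Then the assignment $$\rho_\Phi(\mathcal{P}) := \{ [f] \in R_\Phi \mid \operatorname{cone}(f) \notin \mathcal{P}\}$$ defines an inclusion-reversing, spectral map $$\rho_\Phi : \mathcal{Z}_\Phi \to \operatorname{Spec}(R_\Phi).$$
   Context: A tensor triangulated category is a triangulated category $(\mathcal{K},\Sigma)$ with a symmetric monoidal structure $(\otimes,\mathbb{1})$ such that $a\otimes -$ and $-\otimes a$ are exact functors for every object $a$; the associated suspension isomorphisms $\Sigma a\otimes b\simeq\Sigma(a\otimes b)\simeq a\otimes\Sigma b$ are compatible with the symmetry, associators and unitors, and the two resulting isomorphisms $\Sigma a\otimes\Sigma b\simeq\Sigma^2(a\otimes b)$ differ by the sign $-1$. Associators are suppressed from the notation. $\operatorname{Spc}(\mathcal{K})$ is the set of prime $\otimes$-ideals of $\mathcal{K}$, i.e. proper thick triangulated $\otimes$-ideals $\mathcal{P}$ such that $a\otimes b\in\mathcal{P}$ implies $a\in\mathcal{P}$ or $b\in\mathcal{P}$. Its topology has the sets $\operatorname{supp}(a):=\{\mathcal{P}\mid a\notin\mathcal{P}\}$, $a\in\mathcal{K}$, as a basis of closed sets. It is a spectral space, as is any closed subspace. A spectral map between spectral spaces is a continuous map for which preimages of quasi-compact open sets are quasi-compact. Inclusion-reversing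 means $\mathcal{P}\subset\mathcal{Q}$ implies $\rho(\mathcal{P})\supset\rho(\mathcal{Q})$. For an object $X$, $E_X:=\{f\in[X,X]\mid f\otimes X=X\otimes f \text{ in } [X\otimes X,X\otimes X]\}$ (the ''$\otimes$-balanced'' endomorphisms), a subring of the endomorphism ring $[X,X]$; here $f\otimes X$ means $f\otimes\mathrm{id}_X$, etc. For $a\in\mathcal{K}$ and $f\in E_X$, one has $a\otimes f\in E_{a\otimes X}$ and $f\otimes a\in E_{X\otimes a}$. $R_\Phi$ is the set of pairs $(X,f)$ with $X\in\Phi$, $f\in E_X$, modulo the smallest equivalence relation with $(X,f)\sim(a\otimes X,a\otimes f)$ and $(X,f)\sim(X\otimes a,f\otimes a)$ for all $a\in\Phi$. The class of $(X,f)$ is written $[f]$ or $[f_X]$. $R_\Phi$ is a commutative ring with $[f_X]+[g_Y]=[f_X\otimes Y+X\otimes g_Y]$ and $[f_X]\cdot[g_Y]=[(f_X\otimes Y)\circ(X\otimes g_Y)]$. *)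

(* Defs.v *)
From HB Require Import structures.
From Stdlib Require Import Relation_Operators.
From mathcomp Require Import all_boot all_algebra.
From mathcomp Require Import all_classical topology.

Set Implicit Arguments.
Unset Strict Implicit.
Unset Printing Implicit Defensive.

Import GRing.Theory.
Local Open Scope classical_set_scope.
Local Open Scope ring_scope.
Local Open Scope quotient_scope.

(** * Additive categories *)

Record preadditive := Preadditive {
  ob :> Type ;
  hom : ob -> ob -> zmodType ;
  idm : forall X, hom X X ;
  comp : forall X Y Z, hom Y Z -> hom X Y -> hom X Z ;
  compA : forall X Y Z W (h : hom Z W) (g : hom Y Z) (f : hom X Y),
    comp h (comp g f) = comp (comp h g) f ;
  comp1m : forall X Y (f : hom X Y), comp (idm Y) f = f ;
  compm1 : forall X Y (f : hom X Y), comp f (idm X) = f ;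
  compDl : forall X Y Z (g g' : hom Y Z) (f : hom X Y),
    comp (g + g') f = comp g f + comp g' f ;
  compDr : forall X Y Z (g : hom Y Z) (f f' : hom X Y),
    comp g (f + f') = comp g f + comp g f' }.

Arguments idm {p} X.
Notation "g ∘ f" := (comp g f) (at level 40, left associativity).

Definition is_iso (K : preadditive) (X Y : K) (f : hom X Y) : Prop :=
  exists g : hom Y X, g ∘ f = idm X /\ f ∘ g = idm Y.

Definition isomorphic (K : preadditive) (X Y : K) : Prop :=
  exists f : hom X Y, is_iso f.

(* Initial and terminal: hom-groups being inhabited, a unique morphism is 0. *)
Definition is_zero_object (K : preadditive) (Z : K) : Prop :=
  (forall X (f : hom X Z), f = 0) /\ (forall X (f : hom Z X), f = 0).

Definition is_biproduct (K : preadditive) (A B C : K) : Prop :=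
  exists (i1 : hom A C) (i2 : hom B C) (p1 : hom C A) (p2 : hom C B),
    [/\ p1 ∘ i1 = idm A, p2 ∘ i2 = idm B, p1 ∘ i2 = 0, p2 ∘ i1 = 0
      & i1 ∘ p1 + i2 ∘ p2 = idm C].

Lemma comp0m (K : preadditive) (X Y Z : K) (f : hom X Y) :
  (0 : hom Y Z) ∘ f = 0.
Proof. by apply: (addIr (0 ∘ f)); rewrite -compDl !add0r. Qed.

Lemma compm0 (K : preadditive) (X Y Z : K) (g : hom Y Z) :
  g ∘ (0 : hom X Y) = 0.
Proof. by apply: (addIr (g ∘ 0)); rewrite -compDr !add0r. Qed.

Lemma compBl (K : preadditive) (X Y Z : K) (g g' : hom Y Z) (f : hom X Y) :
  (g - g') ∘ f = g ∘ f - g' ∘ f.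
Proof. by apply: (addIr (g' ∘ f)); rewrite -compDl !subrK. Qed.

Lemma compBr (K : preadditive) (X Y Z : K) (g : hom Y Z) (f f' : hom X Y) :
  g ∘ (f - f') = g ∘ f - g ∘ f'.
Proof. by apply: (addIr (g ∘ f')); rewrite -compDr !subrK. Qed.

Record additive_category := AdditiveCategory {
  additive_preadditive :> preadditive ;
  has_zero_object : exists Z : additive_preadditive, is_zero_object Z ;
  has_biproducts :
    forall A B : additive_preadditive, exists C, is_biproduct A B C }.

(** * Triangulated categories *)

(* [dist f g h] : the triangle X -f-> Y -g-> Z -h-> Sigma X is distinguished. *)
Record triangulated := Triangulated {
  triangulated_additive :> additive_category ;
  sus : triangulated_additive -> triangulated_additive ;
  susm : forall X Y : triangulated_additive,
    hom X Y -> hom (sus X) (sus Y) ;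
  susm1 : forall X, susm (idm X) = idm (sus X) ;
  susmM : forall X Y Z (g : hom Y Z) (f : hom X Y),
    susm (g ∘ f) = susm g ∘ susm f ;
  susmD : forall X Y (f g : hom X Y), susm (f + g) = susm f + susm g ;
  susm_bij : forall X Y, bijective (@susm X Y) ;
  sus_esssurj : forall Y, exists X, isomorphic (sus X) Y ;
  dist : forall X Y Z : triangulated_additive,
    hom X Y -> hom Y Z -> hom Z (sus X) -> Prop ;
  dist_iso : forall X Y Z X' Y' Z'
      (f : hom X Y) (g : hom Y Z) (h : hom Z (sus X))
      (f' : hom X' Y') (g' : hom Y' Z') (h' : hom Z' (sus X'))
      (a : hom X X') (b : hom Y Y') (c : hom Z Z'),
    is_iso a -> is_iso b -> is_iso c ->
    b ∘ f = f' ∘ a -> c ∘ g = g' ∘ b -> susm a ∘ h = h' ∘ c ->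
    dist f g h -> dist f' g' h' ;
  dist_id : forall X Z, is_zero_object Z ->
    dist (idm X) (0 : hom X Z) (0 : hom Z (sus X)) ;
  dist_ex : forall X Y (f : hom X Y),
    exists Z (g : hom Y Z) (h : hom Z (sus X)), dist f g h ;
  dist_rot : forall X Y Z (f : hom X Y) (g : hom Y Z) (h : hom Z (sus X)),
    dist f g h <-> dist g h (- susm f) ;
  dist_mor : forall X Y Z X' Y' Z'
      (f : hom X Y) (g : hom Y Z) (h : hom Z (sus X))
      (f' : hom X' Y') (g' : hom Y' Z') (h' : hom Z' (sus X'))
      (a : hom X X') (b : hom Y Y'),
    dist f g h -> dist f' g' h' -> b ∘ f = f' ∘ a ->
    exists c : hom Z Z', c ∘ g = g' ∘ b /\ susm a ∘ h = h' ∘ c ;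
  dist_oct : forall X Y Z Q1 Q2 Q3 (f : hom X Y) (g : hom Y Z)
      (p1 : hom Y Q1) (d1 : hom Q1 (sus X))
      (p2 : hom Z Q2) (d2 : hom Q2 (sus X))
      (p3 : hom Z Q3) (d3 : hom Q3 (sus Y)),
    dist f p1 d1 -> dist (g ∘ f) p2 d2 -> dist g p3 d3 ->
    exists (a : hom Q1 Q2) (b : hom Q2 Q3),
      [/\ dist a b (susm p1 ∘ d3), a ∘ p1 = p2 ∘ g, d2 ∘ a = d1,
          b ∘ p2 = p3 & d3 ∘ b = susm f ∘ d2] }.

Definition is_cone (K : triangulated) (X Y : K) (f : hom X Y) (C : K) : Prop :=
  exists (g : hom Y C) (h : hom C (sus X)), dist f g h.

(** * Tensor triangulated categories *)

Record symmetric_monoidal (K : preadditive) := SymmetricMonoidal {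
  tens : K -> K -> K ;
  tensm : forall X X' Y Y' : K,
    hom X X' -> hom Y Y' -> hom (tens X Y) (tens X' Y') ;
  unit_ob : K ;
  assoc : forall X Y Z, hom (tens (tens X Y) Z) (tens X (tens Y Z)) ;
  lunit : forall X, hom (tens unit_ob X) X ;
  runit : forall X, hom (tens X unit_ob) X ;
  braid : forall X Y, hom (tens X Y) (tens Y X) ;
  tensm1 : forall X Y, tensm (idm X) (idm Y) = idm (tens X Y) ;
  tensmM : forall X X' X'' Y Y' Y'' (f' : hom X' X'') (f : hom X X')
      (g' : hom Y' Y'') (g : hom Y Y'),
    tensm (f' ∘ f) (g' ∘ g) = tensm f' g' ∘ tensm f g ;
  assoc_iso : forall X Y Z, is_iso (assoc X Y Z) ;
  lunit_iso : forall X, is_iso (lunit X) ;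
  runit_iso : forall X, is_iso (runit X) ;
  assoc_nat : forall X X' Y Y' Z Z'
      (f : hom X X') (g : hom Y Y') (h : hom Z Z'),
    assoc X' Y' Z' ∘ tensm (tensm f g) h =
    tensm f (tensm g h) ∘ assoc X Y Z ;
  lunit_nat : forall X X' (f : hom X X'),
    lunit X' ∘ tensm (idm unit_ob) f = f ∘ lunit X ;
  runit_nat : forall X X' (f : hom X X'),
    runit X' ∘ tensm f (idm unit_ob) = f ∘ runit X ;
  braid_nat : forall X X' Y Y' (f : hom X X') (g : hom Y Y'),
    braid X' Y' ∘ tensm f g = tensm g f ∘ braid X Y ;
  braidK : forall X Y, braid Y X ∘ braid X Y = idm (tens X Y) ;
  pentagon : forall X Y Z W,
    assoc X Y (tens Z W) ∘ assoc (tens X Y) Z W =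
    tensm (idm X) (assoc Y Z W) ∘ assoc X (tens Y Z) W
      ∘ tensm (assoc X Y Z) (idm W) ;
  triangle : forall X Y,
    tensm (idm X) (lunit Y) ∘ assoc X unit_ob Y = tensm (runit X) (idm Y) ;
  hexagon : forall X Y Z,
    assoc Y Z X ∘ braid X (tens Y Z) ∘ assoc X Y Z =
    tensm (idm Y) (braid X Z) ∘ assoc Y X Z ∘ tensm (braid X Y) (idm Z) }.

(* [susl X Y] and [susr X Y] are the suspension isomorphisms that make
   - ⊗ Y and X ⊗ - exact functors. *)
Record tt_compatible (K : triangulated) (M : symmetric_monoidal K) :=
    TTCompatible {
  susl : forall X Y : K,
    hom (tens M (sus X) Y) (sus (tens M X Y)) ;
  susr : forall X Y : K,
    hom (tens M X (sus Y)) (sus (tens M X Y)) ;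
  tensmDl : forall X X' Y (f g : hom X X'),
    tensm M (f + g) (idm Y) =
    tensm M f (idm Y) + tensm M g (idm Y) ;
  tensmDr : forall X Y Y' (f g : hom Y Y'),
    tensm M (idm X) (f + g) =
    tensm M (idm X) f + tensm M (idm X) g ;
  susl_iso : forall X Y, is_iso (susl X Y) ;
  susr_iso : forall X Y, is_iso (susr X Y) ;
  susl_nat : forall X X' Y Y' (f : hom X X') (g : hom Y Y'),
    susl X' Y' ∘ tensm M (susm f) g =
    susm (tensm M f g) ∘ susl X Y ;
  susr_nat : forall X X' Y Y' (f : hom X X') (g : hom Y Y'),
    susr X' Y' ∘ tensm M f (susm g) =
    susm (tensm M f g) ∘ susr X Y ;
  tens_exactl : forall X Y Z W
      (f : hom X Y) (g : hom Y Z) (h : hom Z (sus X)),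
    dist f g h ->
    dist (tensm M f (idm W)) (tensm M g (idm W))
         (susl X W ∘ tensm M h (idm W)) ;
  tens_exactr : forall X Y Z W
      (f : hom X Y) (g : hom Y Z) (h : hom Z (sus X)),
    dist f g h ->
    dist (tensm M (idm W) f) (tensm M (idm W) g)
         (susr W X ∘ tensm M (idm W) h) ;
  sus_braid : forall X Y,
    susm (braid M X Y) ∘ susl X Y =
    susr Y X ∘ braid M (sus X) Y ;
  sus_assoc1 : forall X Y Z,
    susm (assoc M X Y Z) ∘ susl (tens M X Y) Z
      ∘ tensm M (susl X Y) (idm Z) =
    susl X (tens M Y Z) ∘ assoc M (sus X) Y Z ;
  sus_assoc2 : forall X Y Z,
    susm (assoc M X Y Z) ∘ susl (tens M X Y) Z
      ∘ tensm M (susr X Y) (idm Z) =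
    susr X (tens M Y Z) ∘ tensm M (idm X) (susl Y Z)
      ∘ assoc M X (sus Y) Z ;
  sus_assoc3 : forall X Y Z,
    susm (assoc M X Y Z) ∘ susr (tens M X Y) Z =
    susr X (tens M Y Z) ∘ tensm M (idm X) (susr Y Z)
      ∘ assoc M X Y (sus Z) ;
  sus_lunit : forall X,
    susm (lunit M X) ∘ susr (unit_ob M) X =
    lunit M (sus X) ;
  sus_runit : forall X,
    susm (runit M X) ∘ susl X (unit_ob M) =
    runit M (sus X) ;
  sus_sign : forall X Y,
    susm (susr X Y) ∘ susl X (sus Y) = - (susm (susl X Y) ∘ susr (sus X) Y) }.

Record tt_category := TTCategory {
  tt_triangulated :> triangulated ;
  tt_monoidal : symmetric_monoidal tt_triangulated ;
  tt_compat : tt_compatible tt_monoidal }.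

Notation "X ⊗ Y" := (tens (tt_monoidal _) X Y)
  (at level 35, right associativity).
Notation "f ⊗m g" := (tensm (tt_monoidal _) f g)
  (at level 35, right associativity).

(* A fixed universe of small sets; the objects and the hom-groups of a
   category may live in larger ones. *)
Definition small_type := Type.

Definition essentially_small (K : preadditive) : Prop :=
  (exists (S : small_type) (F : S -> K), forall X, exists s, isomorphic X (F s))
  /\ (forall X Y : K, exists (S : small_type) (e : S -> hom X Y), bijective e).

(** * The spectrum of a tensor triangulated category *)

(* Given rotation of triangles, [ideal_sus] and [ideal_cone] yield two-out-of-
   three; isomorphic objects are summands of each other. *)
Record thick_tensor_ideal (K : tt_category) (P : set K) : Prop := {
  ideal_zero : forall Z, is_zero_object Z -> P Z ;
  ideal_sus : forall X, P (sus X) <-> P X ;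
  ideal_cone : forall X Y (f : hom X Y) C, is_cone f C -> P X -> P Y -> P C ;
  ideal_summand : forall A B C, is_biproduct A B C -> P C -> P A /\ P B ;
  ideal_tens : forall A X, P X -> P (A ⊗ X) }.

Record prime_tensor_ideal (K : tt_category) (P : set K) : Prop := {
  prime_ideal : thick_tensor_ideal P ;
  prime_proper : exists X, ~ P X ;
  prime_tens : forall A B, P (A ⊗ B) -> P A \/ P B }.

Record Spc (K : tt_category) := MkSpc {
  spc_set : set K ;
  spc_prime : prime_tensor_ideal spc_set }.

HB.instance Definition _ (K : tt_category) := gen_eqMixin (Spc K).
HB.instance Definition _ (K : tt_category) := gen_choiceMixin (Spc K).

Definition supp (K : tt_category) (a : K) : set (Spc K) :=
  [set P : Spc K | ~ spc_set P a].

Section SpcTopology.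
Variable K : tt_category.

Lemma zero_sus (Z : K) : is_zero_object Z -> is_zero_object (sus Z).
Proof.
move=> [Z1 _]; have e : idm (sus Z) = 0.
  rewrite -susm1 (Z1 _ (idm Z)); apply: (addIr (susm 0)).
  by rewrite -susmD !add0r.
split=> X f; first by rewrite -[f]comp1m e comp0m.
by rewrite -[f]compm1 e compm0.
Qed.

Lemma dist0id (Z W : K) : is_zero_object Z ->
  dist (0 : hom Z W) (idm W) (0 : hom W (sus Z)).
Proof.
move=> Z0; apply/dist_rot; have Z0' := zero_sus Z0.
by have := dist_id W Z0'; rewrite ((Z0').2 _ (- _)).
Qed.

Lemma dist_comp0 (X Y C : K) (f : hom X Y) (g : hom Y C) (h : hom C (sus X)) :
  dist f g h -> h ∘ g = 0.
Proof.
move=> /dist_rot fgh; have [Z Z0] := has_zero_object K.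
have [c [e _]] := dist_mor (a := idm _) (b := g) (dist_id Y Z0) fgh erefl.
by rewrite -e compm0.
Qed.

Lemma dist_coker (X Y C W : K) (f : hom X Y) (g : hom Y C) (h : hom C (sus X))
    (e : hom C W) :
  dist f g h -> e ∘ g = 0 -> exists t : hom (sus X) W, e = t ∘ h.
Proof.
move=> /dist_rot fgh eg; have [Z Z0] := has_zero_object K.
have [|t [te _]] := dist_mor (a := 0) (b := e) fgh (dist0id W Z0).
  by rewrite eg compm0.
by exists t; rewrite te comp1m.
Qed.

Lemma cone0_biproduct (X Y C : K) :
  is_cone (0 : hom X Y) C -> is_biproduct Y (sus X) C.
Proof.
move=> [g [h fgh]]; have [Z Z0] := has_zero_object K.
have [|r [rg _]] :=
    dist_mor (a := 0) (b := idm Y) fgh (dist0id Y Z0).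
  by rewrite !compm0.
rewrite comp1m in rg.
have XX := (dist_rot _ _ _).1 (dist_id X Z0).
have [|c [_ hc]] := dist_mor (a := idm X) (b := 0) XX fgh.
  by rewrite !comp0m.
rewrite susm1 comp1m in hc.
have hg := dist_comp0 fgh.
pose s := g ∘ (r ∘ c) - c.
have hs : h ∘ s = idm (sus X).
  by rewrite /s compBr compA hg comp0m sub0r -hc opprK.
have rs : r ∘ s = 0.
  by rewrite /s compBr compA rg comp1m subrr.
clearbody s.
have [|t et] := dist_coker (e := idm C - g ∘ r - s ∘ h) fgh.
  by rewrite !compBl comp1m -!compA rg hg compm1 compm0 subrr subr0.
exists g, s, r, h; split => //.
have /eqP : idm C - g ∘ r - s ∘ h = 0.
  have : (idm C - g ∘ r - s ∘ h) ∘ s = 0.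
    by rewrite !compBl comp1m -!compA rs hs compm1 compm0 subr0 subrr.
  by rewrite et -compA hs compm1 => ->; rewrite comp0m.
by rewrite -addrA -opprD subr_eq0 => /eqP.
Qed.

Lemma supp_cone0 (a b c : K) :
  is_cone (0 : hom a b) c -> supp c = supp a `|` supp b.
Proof.
move=> abc; apply/seteqP; split => P /=; have I := prime_ideal (spc_prime P).
  move=> nPc; apply: contrapT => /not_orP[/contrapT Pa /contrapT Pb].
  by apply: nPc; exact: ideal_cone abc Pa Pb.
have h := ideal_summand I (cone0_biproduct abc).
by case=> nP /h[Pb /(ideal_sus I)].
Qed.

(* The closed sets are the intersections of sets of the form [supp a]. *)
Definition spc_open (U : set (Spc K)) : Prop :=
  exists A : set K, ~` U = \bigcap_(a in A) supp a.

Lemma spc_openT : spc_open setT.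
Proof.
have [Z Z0] := has_zero_object K; exists [set Z].
rewrite bigcap_set1 setCT; apply/seteqP; split => // P; apply.
exact: ideal_zero (prime_ideal (spc_prime P)) _ Z0.
Qed.

Lemma spc_openI : setI_closed spc_open.
Proof.
move=> U V [A UA] [B VB].
exists [set c | exists a b, [/\ A a, B b & is_cone (0 : hom a b) c]].
rewrite setCI UA VB; apply/seteqP; split => P.
  by move=> PAB c [a [b [Aa Bb abc]]]; rewrite (supp_cone0 abc);
    case: PAB => [/(_ _ Aa)|/(_ _ Bb)]; [left|right].
move=> h; apply: contrapT => /not_orP[].
move=> /existsNP[a /not_implyP[Aa Pa]] /existsNP[b /not_implyP[Bb Pb]].
have [c abc] := dist_ex (0 : hom a b).
have : supp c P by apply: h; exists a, b.
by rewrite (supp_cone0 abc) => -[].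
Qed.

Lemma spc_open_bigcup (I : Type) (f : I -> set (Spc K)) :
  (forall i, spc_open (f i)) -> spc_open (\bigcup_i f i).
Proof.
move=> fo; exists [set a | exists A i, ~` f i = \bigcap_(a in A) supp a /\ A a].
rewrite setC_bigcup; apply/seteqP; split => P.
  by move=> h a [A [i [fA Aa]]]; have := h i Logic.I; rewrite fA; apply.
move=> h i _; have [A fA] := fo i; rewrite fA => a Aa.
by apply: h; exists A, i.
Qed.

HB.instance Definition _ :=
  isOpenTopological.Build (Spc K) spc_openT spc_openI spc_open_bigcup.

End SpcTopology.

(** * The spectrum of a commutative ring *)

(* The library's prime ideals live in non-zero rings only. *)
Record prime_ring_ideal (R : comPzRingType) (p : set R) : Prop := {
  ring_ideal0 : p 0 ;
  ring_idealD : forall x y, p x -> p y -> p (x + y) ;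
  ring_idealMl : forall a x, p x -> p (a * x) ;
  ring_ideal1 : ~ p 1 ;
  ring_idealM : forall x y, p (x * y) -> p x \/ p y }.

Record Spec (R : comPzRingType) := MkSpec {
  spec_set : set R ;
  spec_prime : prime_ring_ideal spec_set }.

HB.instance Definition _ (R : comPzRingType) := gen_eqMixin (Spec R).
HB.instance Definition _ (R : comPzRingType) := gen_choiceMixin (Spec R).

Section SpecTopology.
Variable R : comPzRingType.

Definition spec_open (U : set (Spec R)) : Prop :=
  exists I : set R, ~` U = [set p | I `<=` spec_set p].

Lemma spec_openT : spec_open setT.
Proof.
exists setT; rewrite setCT; apply/seteqP; split => // p /= h.
exact: ring_ideal1 (spec_prime p) (h _ _).
Qed.

Lemma spec_openI : setI_closed spec_open.
Proof.
move=> U V [I UI] [J VJ].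
exists [set z | exists x y, [/\ I x, J y & z = x * y]].
rewrite setCI UI VJ; apply/seteqP; split => p /=.
  move=> pIJ _ [x [y [Ix Jy ->]]]; case: pIJ => h.
    by rewrite mulrC; apply: ring_idealMl (spec_prime p) _ _ (h _ Ix).
  exact: ring_idealMl (spec_prime p) _ _ (h _ Jy).
move=> h; apply: contrapT => /not_orP[].
move=> /existsNP[x /not_implyP[Ix px]] /existsNP[y /not_implyP[Jy py]].
have /(ring_idealM (spec_prime p))[] // : spec_set p (x * y).
by apply: h; exists x, y.
Qed.

Lemma spec_open_bigcup (T : Type) (f : T -> set (Spec R)) :
  (forall i, spec_open (f i)) -> spec_open (\bigcup_i f i).
Proof.
move=> fo; exists [set x | exists I i, ~` f i = [set p | I `<=` spec_set p] /\ I x].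
rewrite setC_bigcup; apply/seteqP; split => p.
  by move=> h x [I [i [fI Ix]]]; have := h i Logic.I; rewrite fI; apply.
move=> h i _; have [I fI] := fo i; rewrite fI => x Ix.
by apply: h; exists I, i.
Qed.

HB.instance Definition _ :=
  isOpenTopological.Build (Spec R) spec_openT spec_openI spec_open_bigcup.

End SpecTopology.

(* [cover_compact] is quasi-compactness: no separation axiom is involved. *)
Definition spectral_map (S T : topologicalType) (f : S -> T) : Prop :=
  continuous f /\
  forall U : set T, open U -> cover_compact U -> cover_compact (f @^-1` U).

(** * The ring R_Phi *)

Section Balanced.
Variable K : tt_category.
Implicit Types X Y Z A : K.

Definition tensor_closed (Phi : set K) : Prop :=
  forall X Y, Phi X -> Phi Y -> Phi (X ⊗ Y).

Definition balanced X (f : hom X X) : Prop := f ⊗m idm X = idm X ⊗m f.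

Lemma tensMl X Y Z A (f : hom Y Z) (g : hom X Y) :
  (f ∘ g) ⊗m idm A = (f ⊗m idm A) ∘ (g ⊗m idm A).
Proof. by rewrite -tensmM comp1m. Qed.

Lemma tensMr X Y Z A (f : hom Y Z) (g : hom X Y) :
  idm A ⊗m (f ∘ g) = (idm A ⊗m f) ∘ (idm A ⊗m g).
Proof. by rewrite -tensmM comp1m. Qed.

Lemma tens0l X Y A : (0 : hom X Y) ⊗m idm A = 0.
Proof. by apply: (addIr (0 ⊗m idm A)); rewrite -(tensmDl (tt_compat K)) !add0r. Qed.

Lemma tens0r X Y A : idm A ⊗m (0 : hom X Y) = 0.
Proof. by apply: (addIr (idm A ⊗m 0)); rewrite -(tensmDr (tt_compat K)) !add0r. Qed.

Lemma iso_epi X Y Z (f : hom X Y) (a b : hom Y Z) :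
  is_iso f -> a ∘ f = b ∘ f -> a = b.
Proof.
by move=> [g [_ fg]] e; rewrite -[a]compm1 -[b]compm1 -fg !compA e.
Qed.

Lemma iso_mono X Y Z (f : hom Y Z) (a b : hom X Y) :
  is_iso f -> f ∘ a = f ∘ b -> a = b.
Proof.
by move=> [g [gf _]] e; rewrite -[a]comp1m -[b]comp1m -gf -!compA e.
Qed.

Lemma is_iso_id X : is_iso (idm X).
Proof. by exists (idm X); rewrite comp1m. Qed.

Lemma is_iso_braid X Y : is_iso (braid (tt_monoidal K) X Y).
Proof. by exists (braid _ Y X); rewrite !braidK. Qed.

Lemma is_iso_tens X X' Y Y' (f : hom X X') (g : hom Y Y') :
  is_iso f -> is_iso g -> is_iso (f ⊗m g).
Proof.
move=> [f' [ff' f'f]] [g' [gg' g'g]]; exists (f' ⊗m g').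
by rewrite -!tensmM ff' gg' f'f g'g !tensm1.
Qed.

Lemma balanced0 X : balanced (0 : hom X X).
Proof. by rewrite /balanced tens0l tens0r. Qed.

Lemma balanced1 X : balanced (idm X).
Proof. by []. Qed.

Lemma balancedD X (f g : hom X X) :
  balanced f -> balanced g -> balanced (f + g).
Proof.
rewrite /balanced (tensmDl (tt_compat K)) (tensmDr (tt_compat K)).
by move=> -> ->.
Qed.

Lemma balancedN X (f : hom X X) : balanced f -> balanced (- f).
Proof.
move=> bf; rewrite /balanced; apply: (addIr (f ⊗m idm X)).
rewrite -(tensmDl (tt_compat K)) [in RHS]bf -(tensmDr (tt_compat K)).
by rewrite addNr tens0l tens0r.
Qed.

Lemma balancedM X (f g : hom X X) :
  balanced f -> balanced g -> balanced (f ∘ g).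
Proof. by rewrite /balanced tensMl tensMr => -> ->. Qed.

Lemma balanced_conj X Y (f : hom X X) (g : hom Y Y) (p : hom X Y) :
  is_iso p -> p ∘ f = g ∘ p -> balanced f -> balanced g.
Proof.
move=> ip pf bf; apply: (iso_epi (is_iso_tens ip ip)).
rewrite -!tensmM !comp1m -pf -[in LHS](compm1 p) -[in RHS](compm1 p).
by rewrite compm1 -[p in _ ⊗m p]compm1 !tensmM bf -!tensmM !compm1.
Qed.

Lemma balanced_shift X A (f : hom X X) : balanced f ->
  f ⊗m idm (A ⊗ X) = idm X ⊗m (idm A ⊗m f).
Proof.
move=> bf.
have e : f ⊗m idm (X ⊗ A) = idm X ⊗m (f ⊗m idm A).
  apply: (iso_epi (assoc_iso (tt_monoidal K) X X A)).
  by rewrite -tensm1 -!assoc_nat bf.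
apply: (iso_epi (is_iso_tens (is_iso_id X) (is_iso_braid X A))).
rewrite -tensmM compm1 comp1m -tensmM comp1m -braid_nat.
by rewrite tensMr -e -tensmM comp1m compm1.
Qed.

Lemma balanced_tensl X A (f : hom X X) : balanced f -> balanced (idm A ⊗m f).
Proof.
move=> bf; apply: (iso_mono (assoc_iso (tt_monoidal K) A X (A ⊗ X))).
by rewrite assoc_nat (balanced_shift A bf) -assoc_nat tensm1.
Qed.

Lemma balanced_tensr X A (f : hom X X) : balanced f -> balanced (f ⊗m idm A).
Proof.
move=> bf; apply: balanced_conj (is_iso_braid A X) _ (balanced_tensl A bf).
exact: braid_nat.
Qed.

End Balanced.

Section BalancedPairs.
Variables (K : tt_category) (Phi : set K).

Record balanced_pair := BalancedPair {
  pair_ob : K ;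
  pair_mem : Phi pair_ob ;
  pair_mor : hom pair_ob pair_ob ;
  pair_balanced : balanced pair_mor }.

HB.instance Definition _ := gen_eqMixin balanced_pair.
HB.instance Definition _ := gen_choiceMixin balanced_pair.

Hypothesis hcl : tensor_closed Phi.
Implicit Types F G H : balanced_pair.

Definition pair_tensl (A : K) (hA : Phi A) F : balanced_pair :=
  BalancedPair (hcl hA (pair_mem F)) (balanced_tensl A (pair_balanced F)).

Definition pair_tensr (A : K) (hA : Phi A) F : balanced_pair :=
  BalancedPair (hcl (pair_mem F) hA) (balanced_tensr A (pair_balanced F)).

Inductive pair_step : balanced_pair -> balanced_pair -> Prop :=
| pair_stepl A (hA : Phi A) F : pair_step F (pair_tensl hA F)
| pair_stepr A (hA : Phi A) F : pair_step F (pair_tensr hA F).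

Definition pair_equiv : balanced_pair -> balanced_pair -> Prop :=
  clos_refl_sym_trans _ pair_step.

Definition pair_equivb : rel balanced_pair := fun F G => `[< pair_equiv F G >].

Lemma pair_equivb_refl : reflexive pair_equivb.
Proof. by move=> F; apply/asboolP; exact: rst_refl. Qed.

Lemma pair_equivb_sym : symmetric pair_equivb.
Proof.
by move=> F G; apply/asboolP/asboolP => ?; exact: rst_sym.
Qed.

Lemma pair_equivb_trans : transitive pair_equivb.
Proof.
by move=> F G H /asboolP ? /asboolP ?; apply/asboolP; apply: rst_trans; eauto.
Qed.

Definition pair_equiv_rel :=
  EquivRel pair_equivb pair_equivb_refl pair_equivb_sym pair_equivb_trans.

Definition pair_add F G : balanced_pair :=
  BalancedPair (hcl (pair_mem F) (pair_mem G))
    (balancedD (balanced_tensr (pair_ob G) (pair_balanced F))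
               (balanced_tensl (pair_ob F) (pair_balanced G))).

Definition pair_mul F G : balanced_pair :=
  BalancedPair (hcl (pair_mem F) (pair_mem G))
    (balancedM (balanced_tensr (pair_ob G) (pair_balanced F))
               (balanced_tensl (pair_ob F) (pair_balanced G))).

Definition pair_opp F : balanced_pair :=
  BalancedPair (pair_mem F) (balancedN (pair_balanced F)).

Lemma pair_eq X (hX hX' : Phi X) (f g : hom X X) (bf : balanced f)
  (bg : balanced g) : f = g -> BalancedPair hX bf = BalancedPair hX' bg.
Proof.
move=> e; case: _ / e in bg *.
by rewrite (Prop_irrelevance hX hX') (Prop_irrelevance bf bg).
Qed.

Lemma pair_equivl A (hA : Phi A) F : pair_equiv (pair_tensl hA F) F.
Proof. by apply: rst_sym; apply: rst_step; exact: pair_stepl. Qed.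

Lemma pair_equivr A (hA : Phi A) F : pair_equiv (pair_tensr hA F) F.
Proof. by apply: rst_sym; apply: rst_step; exact: pair_stepr. Qed.

Lemma pair_conj F G (p : hom (pair_ob F) (pair_ob G)) :
  is_iso p -> p ∘ pair_mor F = pair_mor G ∘ p -> pair_equiv F G.
Proof.
move=> ip pf; apply: rst_trans (pair_equivl (pair_mem F) G).
apply: rst_trans (rst_sym _ _ _ _ (pair_equivr (pair_mem G) F)) _.
rewrite (_ : pair_tensr _ F = pair_tensl (pair_mem F) G); first exact: rst_refl.
apply: pair_eq; apply: (iso_epi (is_iso_tens (is_iso_id _) ip)).
rewrite -[RHS]tensMr -pf tensMr -(pair_balanced F) -!tensmM.
by rewrite !compm1 !comp1m.
Qed.

Lemma pair_mul_mor F G :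
  pair_mor (pair_mul F G) = pair_mor F ⊗m pair_mor G.
Proof. by rewrite /= -tensmM compm1 comp1m. Qed.

Lemma pair_addC F G : pair_equiv (pair_add F G) (pair_add G F).
Proof.
apply: (@pair_conj (pair_add F G) (pair_add G F)
  (braid _ (pair_ob F) (pair_ob G))) (is_iso_braid _ _) _ => /=.
by rewrite compDl compDr !braid_nat addrC.
Qed.

Lemma pair_mulC F G : pair_equiv (pair_mul F G) (pair_mul G F).
Proof.
apply: (@pair_conj (pair_mul F G) (pair_mul G F)
  (braid _ (pair_ob F) (pair_ob G))) (is_iso_braid _ _) _.
by rewrite !pair_mul_mor braid_nat.
Qed.

Lemma pair_add_conj F F' G (p : hom (pair_ob F) (pair_ob F')) :
  is_iso p -> p ∘ pair_mor F = pair_mor F' ∘ p ->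
  pair_equiv (pair_add F G) (pair_add F' G).
Proof.
move=> ip pf.
apply: (@pair_conj (pair_add F G) (pair_add F' G) (p ⊗m idm (pair_ob G))).
  exact: is_iso_tens ip (is_iso_id _).
by rewrite /= compDl compDr -!tensmM pf !comp1m !compm1.
Qed.

Lemma pair_mul_conj F F' G (p : hom (pair_ob F) (pair_ob F')) :
  is_iso p -> p ∘ pair_mor F = pair_mor F' ∘ p ->
  pair_equiv (pair_mul F G) (pair_mul F' G).
Proof.
move=> ip pf.
apply: (@pair_conj (pair_mul F G) (pair_mul F' G) (p ⊗m idm (pair_ob G))).
  exact: is_iso_tens ip (is_iso_id _).
by rewrite !pair_mul_mor -!tensmM pf comp1m compm1.
Qed.

Lemma pair_add_tensl A (hA : Phi A) F G :
  pair_equiv (pair_add F G) (pair_add (pair_tensl hA F) G).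
Proof.
apply: rst_trans (rst_sym _ _ _ _ (pair_equivl hA _)) _.
apply: rst_sym; apply: (@pair_conj (pair_add (pair_tensl hA F) G)
  (pair_tensl hA (pair_add F G)) (assoc _ A (pair_ob F) (pair_ob G)))
  (assoc_iso _ _ _ _) _ => /=.
by rewrite compDr assoc_nat -tensm1 assoc_nat -compDl -(tensmDr (tt_compat K)).
Qed.

Lemma pair_mul_tensl A (hA : Phi A) F G :
  pair_equiv (pair_mul F G) (pair_mul (pair_tensl hA F) G).
Proof.
apply: rst_trans (rst_sym _ _ _ _ (pair_equivl hA _)) _.
apply: rst_sym; apply: (@pair_conj (pair_mul (pair_tensl hA F) G)
  (pair_tensl hA (pair_mul F G)) (assoc _ A (pair_ob F) (pair_ob G)))
  (assoc_iso _ _ _ _) _.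
rewrite pair_mul_mor [in RHS]/pair_tensl /= -tensmM compm1 comp1m.
exact: assoc_nat.
Qed.

Lemma pair_tens_swap A (hA : Phi A) F :
  braid (tt_monoidal K) A (pair_ob F) ∘ pair_mor (pair_tensl hA F) =
  pair_mor (pair_tensr hA F) ∘ braid (tt_monoidal K) A (pair_ob F).
Proof. exact: braid_nat. Qed.

Lemma pair_add_congl F F' G :
  pair_equiv F F' -> pair_equiv (pair_add F G) (pair_add F' G).
Proof.
elim=> [{}F {}F' [A hA H|A hA H]|H|H H' _|H1 H2 H3 _ h12 _ h23].
- exact: pair_add_tensl.
- apply: rst_trans (pair_add_tensl hA H G) _.
  exact: (pair_add_conj (F := pair_tensl hA H) (F' := pair_tensr hA H) G
    (is_iso_braid A (pair_ob H)) (pair_tens_swap hA H)).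
- exact: rst_refl.
- exact: rst_sym.
- exact: rst_trans h12 h23.
Qed.

Lemma pair_mul_congl F F' G :
  pair_equiv F F' -> pair_equiv (pair_mul F G) (pair_mul F' G).
Proof.
elim=> [{}F {}F' [A hA H|A hA H]|H|H H' _|H1 H2 H3 _ h12 _ h23].
- exact: pair_mul_tensl.
- apply: rst_trans (pair_mul_tensl hA H G) _.
  exact: (pair_mul_conj (F := pair_tensl hA H) (F' := pair_tensr hA H) G
    (is_iso_braid A (pair_ob H)) (pair_tens_swap hA H)).
- exact: rst_refl.
- exact: rst_sym.
- exact: rst_trans h12 h23.
Qed.

Lemma pair_add_cong F F' G G' : pair_equiv F F' -> pair_equiv G G' ->
  pair_equiv (pair_add F G) (pair_add F' G').
Proof.
move=> hF hG; apply: rst_trans (pair_add_congl G hF) _.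
apply: rst_trans (pair_addC _ _) _; apply: rst_trans (pair_addC _ _).
exact: pair_add_congl.
Qed.

Lemma pair_mul_cong F F' G G' : pair_equiv F F' -> pair_equiv G G' ->
  pair_equiv (pair_mul F G) (pair_mul F' G').
Proof.
move=> hF hG; apply: rst_trans (pair_mul_congl G hF) _.
apply: rst_trans (pair_mulC _ _) _; apply: rst_trans (pair_mulC _ _).
exact: pair_mul_congl.
Qed.

End BalancedPairs.

(* Without [hne] there need not be a 0 and a 1. *)
Definition R_ (K : tt_category) (Phi : set K) (hne : Phi !=set0)
    (hcl : tensor_closed Phi) : Type :=
  {eq_quot (pair_equiv_rel hcl)}.

Section Ring.
Variables (K : tt_category) (Phi : set K).
Variables (hne : Phi !=set0) (hcl : tensor_closed Phi).

Local Notation R := (R_ hne hcl).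

HB.instance Definition _ := Choice.copy R {eq_quot (pair_equiv_rel hcl)}.

Definition pair_class (F : balanced_pair Phi) : R :=
  \pi_({eq_quot (pair_equiv_rel hcl)}) F.

Definition pair_repr (x : R) : balanced_pair Phi :=
  repr (x : {eq_quot (pair_equiv_rel hcl)}).

Lemma pair_reprK (x : R) : pair_class (pair_repr x) = x.
Proof. exact: reprK. Qed.

Lemma pair_classP F G : pair_class F = pair_class G <-> pair_equiv hcl F G.
Proof. by split=> [/eqmodP/asboolP|h]//; apply/eqmodP/asboolP. Qed.

Definition some_ob : K := sval (cid hne).
Definition some_mem : Phi some_ob := svalP (cid hne).

Definition R_zero : R := pair_class (BalancedPair some_mem (balanced0 _)).
Definition R_one : R := pair_class (BalancedPair some_mem (balanced1 _)).
Definition R_add (x y : R) : R :=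
  pair_class (pair_add hcl (pair_repr x) (pair_repr y)).
Definition R_mul (x y : R) : R :=
  pair_class (pair_mul hcl (pair_repr x) (pair_repr y)).
Definition R_opp (x : R) : R := pair_class (pair_opp (pair_repr x)).

Lemma R_addE F G :
  R_add (pair_class F) (pair_class G) = pair_class (pair_add hcl F G).
Proof.
by apply/pair_classP; apply: pair_add_cong; apply/pair_classP;
  rewrite pair_reprK.
Qed.

Lemma R_mulE F G :
  R_mul (pair_class F) (pair_class G) = pair_class (pair_mul hcl F G).
Proof.
by apply/pair_classP; apply: pair_mul_cong; apply/pair_classP;
  rewrite pair_reprK.
Qed.

Lemma R_addD X (hX : Phi X) (f g : hom X X) (bf : balanced f)
    (bg : balanced g) :
  R_add (pair_class (BalancedPair hX bf)) (pair_class (BalancedPair hX bg)) =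
  pair_class (BalancedPair hX (balancedD bf bg)).
Proof.
rewrite R_addE; apply/pair_classP.
apply: rst_trans (pair_equivr hcl hX _).
rewrite (_ : pair_add _ _ _ = pair_tensr hcl hX (BalancedPair hX (balancedD bf bg))).
  exact: rst_refl.
by apply: pair_eq => /=; rewrite -bg (tensmDl (tt_compat K)).
Qed.

Lemma R_mulM X (hX : Phi X) (f g : hom X X) (bf : balanced f)
    (bg : balanced g) :
  R_mul (pair_class (BalancedPair hX bf)) (pair_class (BalancedPair hX bg)) =
  pair_class (BalancedPair hX (balancedM bf bg)).
Proof.
rewrite R_mulE; apply/pair_classP.
apply: rst_trans (pair_equivr hcl hX _).
rewrite (_ : pair_mul _ _ _ = pair_tensr hcl hX (BalancedPair hX (balancedM bf bg))).
  exact: rst_refl.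
by apply: pair_eq => /=; rewrite -bg tensMl.
Qed.

Lemma R_tensl A (hA : Phi A) F : pair_class F = pair_class (pair_tensl hcl hA F).
Proof. by apply/pair_classP; apply: rst_sym; exact: pair_equivl. Qed.

Lemma R_tensr A (hA : Phi A) F : pair_class F = pair_class (pair_tensr hcl hA F).
Proof. by apply/pair_classP; apply: rst_sym; exact: pair_equivr. Qed.

Lemma common_repr (x y z : R) :
  exists X (hX : Phi X) (f g h : hom X X)
    (bf : balanced f) (bg : balanced g) (bh : balanced h),
    [/\ x = pair_class (BalancedPair hX bf),
        y = pair_class (BalancedPair hX bg)
      & z = pair_class (BalancedPair hX bh)].
Proof.
pose F := pair_repr x; pose G := pair_repr y; pose H := pair_repr z.
rewrite -[x]pair_reprK -[y]pair_reprK -[z]pair_reprK -/F -/G -/H.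
exists ((pair_ob F ⊗ pair_ob G) ⊗ pair_ob H).
exists (hcl (hcl (pair_mem F) (pair_mem G)) (pair_mem H)).
exists ((pair_mor F ⊗m idm _) ⊗m idm _), ((idm _ ⊗m pair_mor G) ⊗m idm _).
exists (idm _ ⊗m pair_mor H).
exists (balanced_tensr _ (balanced_tensr _ (pair_balanced F))).
exists (balanced_tensr _ (balanced_tensl _ (pair_balanced G))).
exists (balanced_tensl _ (pair_balanced H)); split.
- rewrite (R_tensr (pair_mem G)) (R_tensr (pair_mem H)).
  by congr pair_class; exact: pair_eq.
- rewrite (R_tensl (pair_mem F)) (R_tensr (pair_mem H)).
  by congr pair_class; exact: pair_eq.
- rewrite (R_tensl (hcl (pair_mem F) (pair_mem G))).
  by congr pair_class; exact: pair_eq.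
Qed.

Lemma pair_class_eq X (hX : Phi X) (f g : hom X X) (bf : balanced f)
    (bg : balanced g) :
  f = g -> pair_class (BalancedPair hX bf) = pair_class (BalancedPair hX bg).
Proof. by move=> e; congr pair_class; exact: pair_eq. Qed.

Lemma R_addA : associative R_add.
Proof.
move=> x y z; have [X [hX [f [g [h [bf [bg [bh [-> -> ->]]]]]]]]] :=
  common_repr x y z.
by rewrite !R_addD; apply: pair_class_eq; rewrite addrA.
Qed.

Lemma R_addC : commutative R_add.
Proof.
move=> x y; rewrite -[x]pair_reprK -[y]pair_reprK !R_addE.
by apply/pair_classP; exact: pair_addC.
Qed.

Lemma R_add0 : left_id R_zero R_add.
Proof.
move=> x; rewrite -[x]pair_reprK R_addE (R_tensl some_mem (pair_repr x)).
congr pair_class; apply: pair_eq => /=.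
by rewrite tens0l add0r.
Qed.

Lemma R_addN : left_inverse R_zero R_opp R_add.
Proof.
move=> x; rewrite -[x in R_add _ x]pair_reprK /R_opp.
case: (pair_repr x) => X hX f bf; rewrite R_addD.
rewrite /R_zero (R_tensl hX (BalancedPair some_mem _)).
rewrite (R_tensr some_mem (BalancedPair hX _)).
by congr pair_class; apply: pair_eq; rewrite /= addNr tens0l tens0r.
Qed.

HB.instance Definition _ :=
  GRing.isZmodule.Build R R_addA R_addC R_add0 R_addN.

Lemma R_mulA : associative R_mul.
Proof.
move=> x y z; have [X [hX [f [g [h [bf [bg [bh [-> -> ->]]]]]]]]] :=
  common_repr x y z.
by rewrite !R_mulM; apply: pair_class_eq; rewrite compA.
Qed.

Lemma R_mulC : commutative R_mul.
Proof.
move=> x y; rewrite -[x]pair_reprK -[y]pair_reprK !R_mulE.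
by apply/pair_classP; exact: pair_mulC.
Qed.

Lemma R_mul1 : left_id R_one R_mul.
Proof.
move=> x; rewrite -[x]pair_reprK R_mulE (R_tensl some_mem (pair_repr x)).
congr pair_class; apply: pair_eq => /=.
by rewrite tensm1 comp1m.
Qed.

Lemma R_mulDl : left_distributive R_mul R_add.
Proof.
move=> x y z; have [X [hX [f [g [h [bf [bg [bh [-> -> ->]]]]]]]]] :=
  common_repr x y z.
by rewrite R_addD !R_mulM R_addD; apply: pair_class_eq; rewrite compDl.
Qed.

HB.instance Definition _ :=
  GRing.Zmodule_isComPzRing.Build R R_mulA R_mulC R_mul1 R_mulDl.

End Ring.

(** * The comparison map *)

Definition Z_ (K : tt_category) (Phi : set K) : set (Spc K) :=
  \bigcap_(X in Phi) supp X.

(* A cone of f is unique up to isomorphism and P is closed under isomorphism,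
   so the choice of the cone C does not matter. *)
Definition rho_set (K : tt_category) (Phi : set K) (hne : Phi !=set0)
    (hcl : tensor_closed Phi) (P : Spc K) : set (R_ hne hcl) :=
  [set r | exists (F : balanced_pair Phi) (C : K),
    [/\ r = pair_class hne hcl F, is_cone (pair_mor F) C & ~ spc_set P C]].

Arguments rho_set {K Phi} hne hcl P.

(* Main.v *)
(* If [C] is a cone of a balanced [f], then [C ⊗ f²] = 0, because [f] can be
   moved across the tensor factors. So, for P in Z_Phi, tensoring with cones
   turns balanced endomorphisms into commuting nilpotent ones, and a nilpotent
   endomorphism has its cone in P only if its source is in P. This makes
   rho(P) closed under sums and multiples, while the octahedral axiom makes it
   prime. The preimage of a basic open set D([f]) is
   {P in Z_Phi | cone(f) in P}. Were it not quasi-compact, Zorn's lemma would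
   give a prime containing cone(f), disjoint from Phi and avoiding the given
   open cover. *)
From mathcomp Require Import all_boot all_algebra.
From mathcomp Require Import finmap all_classical topology.
Require Import Defs.

Set Implicit Arguments.
Unset Strict Implicit.

Import GRing.Theory.
Local Open Scope classical_set_scope.
Local Open Scope ring_scope.

(** * Thick ideals and cones *)

Section ThickIdeals.
Variable K : tt_category.
Implicit Types (P J : set K) (X Y Z A B C W : K).

Local Notation α := (assoc (tt_monoidal K)).
Local Notation β := (braid (tt_monoidal K)).

Lemma dist_comp0l X Y Z (f : hom X Y) (g : hom Y Z) (h : hom Z (sus X)) :
  dist f g h -> g ∘ f = 0.
Proof.
move=> fgh; have [O O0] := has_zero_object K.
have [c [<- _]] := dist_mor (a := idm X) (b := f) (dist_id X O0) fgh erefl.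
by rewrite compm0.
Qed.

Lemma ideal_iso P X Y :
  thick_tensor_ideal P -> isomorphic X Y -> P X -> P Y.
Proof.
move=> I [p [q [qp pq]]]; have [O O0] := has_zero_object K.
have : is_biproduct Y O X.
  by exists q, 0, p, 0; split; rewrite ?compm0 ?comp0m ?addr0 ?(O0.1 _ (idm O)).
by move=> /(ideal_summand I) h /h[].
Qed.

Lemma ideal_tensC P X Y : thick_tensor_ideal P -> P (X ⊗ Y) -> P (Y ⊗ X).
Proof.
by move=> I; apply: (ideal_iso I); exists (β X Y); exact: is_iso_braid.
Qed.

(** Two rotations exhibit [sus Y] as a cone of [h]. *)
Lemma ideal_mid P X Y (f : hom X Y) C :
  thick_tensor_ideal P -> is_cone f C -> P X -> P C -> P Y.
Proof.
move=> I [g [h /dist_rot/dist_rot fgh]] PX PC; apply/(ideal_sus I).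
apply: (ideal_cone I (f := h) _ PC); last exact/(ideal_sus I).
by exists (- susm f), (- susm g).
Qed.

(** The octahedron on [f ∘ idm X] gives a triangle [O -> C' -> C] with [O] zero, so no isomorphism
    of cones has to be built. *)
Lemma cone_unique P X Y (f : hom X Y) C C' :
  thick_tensor_ideal P -> is_cone f C -> is_cone f C' -> P C -> P C'.
Proof.
move=> I [g [h fgh]] [g' [h' fgh']] PC; have [O O0] := has_zero_object K.
have fgh1 : dist (f ∘ idm X) g' h' by rewrite compm1.
have [a [b [abc _ _ _ _]]] := dist_oct (dist_id X O0) fgh1 fgh.
apply: (ideal_mid I (f := a)) (ideal_zero I O0) PC.
by exists b, (susm 0 ∘ h).
Qed.

Lemma ideal_assocV P X Y Z :
  thick_tensor_ideal P -> P (X ⊗ (Y ⊗ Z)) -> P ((X ⊗ Y) ⊗ Z).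
Proof.
move=> I; apply: (ideal_iso I).
by have [a [a1 a2]] := assoc_iso (tt_monoidal K) X Y Z; exists a, (α X Y Z).
Qed.

Definition cone_in P X Y (f : hom X Y) : Prop := exists2 C, is_cone f C & P C.

Lemma cone_inE P X Y (f : hom X Y) C :
  thick_tensor_ideal P -> is_cone f C -> cone_in P f <-> P C.
Proof.
by move=> I fC; split=> [[C' fC' PC']|]; [exact: cone_unique I fC' fC PC'|exists C].
Qed.

Lemma has_cone X Y (f : hom X Y) : exists C, is_cone f C.
Proof. by have [C [g [h]]] := dist_ex f; exists C, g, h. Qed.

Lemma cone_in_id P X : thick_tensor_ideal P -> cone_in P (idm X).
Proof.
move=> I; have [O O0] := has_zero_object K.
by exists O; [exists 0, 0; exact: dist_id|exact: ideal_zero I _ O0].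
Qed.

Lemma cone_in0 P X Y :
  thick_tensor_ideal P -> cone_in P (0 : hom X Y) -> P X.
Proof.
move=> I [C /cone0_biproduct XC /(ideal_summand I XC)[_]].
by move/(ideal_sus I).
Qed.

(** The octahedral axiom places a cone of [g ∘ f] between cones of [f] and of [g]. *)
Lemma cone_in_comp P X Y Z (f : hom X Y) (g : hom Y Z) :
  thick_tensor_ideal P -> cone_in P f -> cone_in P g -> cone_in P (g ∘ f).
Proof.
move=> I [A [p1 [d1 fA]] PA] [B [p3 [d3 gB]] PB].
have [C [p2 [d2 gfC]]] := dist_ex (g ∘ f).
have [a [b [abc _ _ _ _]]] := dist_oct fA gfC gB.
exists C; first by exists p2, d2.
by apply: (ideal_mid I (f := a)) PA PB; exists b, (susm p1 ∘ d3).
Qed.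

Lemma is_cone_tensl A X Y (f : hom X Y) C :
  is_cone f C -> is_cone (idm A ⊗m f) (A ⊗ C).
Proof.
move=> [g [h /(tens_exactr (tt_compat K) A) fgh]].
by exists (idm A ⊗m g), (susr (tt_compat K) A X ∘ (idm A ⊗m h)).
Qed.

Lemma is_cone_tensr A X Y (f : hom X Y) C :
  is_cone f C -> is_cone (f ⊗m idm A) (C ⊗ A).
Proof.
move=> [g [h /(tens_exactl (tt_compat K) A) fgh]].
by exists (g ⊗m idm A), (susl (tt_compat K) X A ∘ (h ⊗m idm A)).
Qed.

Lemma cone_in_tensl P A X Y (f : hom X Y) :
  thick_tensor_ideal P -> cone_in P f -> cone_in P (idm A ⊗m f).
Proof.
move=> I [C fC PC]; exists (A ⊗ C); first exact: is_cone_tensl.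
exact: ideal_tens.
Qed.

(** Relations between balanced endomorphisms are obtained after tensoring with different objects;
    this lemma and the next carry them to one common product. *)
Lemma tens_eq_tensl A W X Y (u v : hom X Y) :
  idm W ⊗m u = idm W ⊗m v -> idm (A ⊗ W) ⊗m u = idm (A ⊗ W) ⊗m v.
Proof.
move=> uv; apply: (iso_mono (assoc_iso (tt_monoidal K) A W Y)).
by rewrite -tensm1 !assoc_nat uv.
Qed.

Lemma tens_eq_tensr A W X Y (u v : hom X Y) :
  idm W ⊗m u = idm W ⊗m v -> idm (W ⊗ A) ⊗m u = idm (W ⊗ A) ⊗m v.
Proof.
move=> /(tens_eq_tensl A) uv.
apply: (iso_mono (is_iso_tens (is_iso_braid W A) (is_iso_id Y))).
rewrite -!tensmM compm1 !comp1m -[β W A]comp1m -[u]compm1 -[v]compm1.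
by rewrite !tensmM uv.
Qed.

(* [C ⊗ f] vanishes on the image of [X ⊗ X] and has zero composite to
   [ΣX ⊗ X], since there [f] may be moved to the other tensor factor. *)
Lemma balanced_cone_sq X (f : hom X X) C :
  balanced f -> is_cone f C -> idm C ⊗m (f ∘ f) = 0.
Proof.
move=> bf [g [h fgh]].
have gf := dist_comp0l fgh.
have fh : susm f ∘ h = 0.
  by have /dist_comp0/eqP := (dist_rot _ _ _).1 fgh;
    rewrite -[- _]sub0r compBl comp0m sub0r oppr_eq0 => /eqP.
have [|t et] := dist_coker (e := idm C ⊗m f)
    (tens_exactl (tt_compat K) X fgh).
  rewrite -tensmM comp1m compm1 -[g]compm1 -[f]comp1m tensmM -bf.
  by rewrite -tensMl gf tens0l.
rewrite tensMr {1}et -!compA -tensmM comp1m compm1.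
rewrite -[h]comp1m -[f]compm1 tensmM (compA (susl _ _ _)) -susm1 susl_nat.
rewrite -[idm X ⊗m f]bf -susl_nat -compA -tensMl fh tens0l.
by rewrite !compm0.
Qed.

(** Balancedness moves [g] to the other tensor factor, where the interchange law commutes it past
    [f]. *)
Lemma balanced_comm X (f g : hom X X) :
  balanced f -> balanced g -> idm X ⊗m (f ∘ g) = idm X ⊗m (g ∘ f).
Proof.
move=> bf bg; rewrite tensMr -bg -tensmM.
by rewrite compm1 comp1m -[g]compm1 -[f]comp1m tensmM compm1 comp1m bg -tensMr.
Qed.

(** All powers of [idm W ⊗m u] have their cone in [P], and a cone of the vanishing power has
    [sus (W ⊗ X)] as a summand. *)
Lemma ideal_nilpotent P W X (u : hom X X) (n : nat) :
  thick_tensor_ideal P -> iter n (comp (idm W ⊗m u)) (idm (W ⊗ X)) = 0 ->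
  cone_in P u -> P (W ⊗ X).
Proof.
move=> I u0 Pu; apply: (cone_in0 I (Y := W ⊗ X)); rewrite -u0.
elim: n {u0} => [|n Pn] /=; first exact: cone_in_id.
by apply: cone_in_comp => //; exact: cone_in_tensl.
Qed.

Lemma comp_nilpotent X (a b : hom X X) :
  a ∘ b = b ∘ a -> a ∘ a = 0 -> iter 2 (comp (b ∘ a)) (idm X) = 0.
Proof.
by move=> ab a2; rewrite /= compm1 -!compA [a ∘ _]compA ab -[b ∘ a ∘ a]compA
  a2 !compm0.
Qed.

(** Here [(a + b)^2 = 2ba], and a third factor repeats [a] or [b]. *)
Lemma add_nilpotent X (a b : hom X X) :
  a ∘ b = b ∘ a -> a ∘ a = 0 -> b ∘ b = 0 ->
  iter 3 (comp (a + b)) (idm X) = 0.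
Proof.
move=> ab a2 b2; have ab2 : (a + b) ∘ (a + b) = b ∘ a + b ∘ a.
  by rewrite !(compDl, compDr) a2 b2 add0r addr0 ab.
rewrite /= compm1 ab2 !(compDl, compDr) !compA ab b2 -[b ∘ a ∘ a]compA a2.
by rewrite compm0 comp0m !addr0.
Qed.

End ThickIdeals.

(** * The comparison map on points *)

Section RhoPrime.
Variables (K : tt_category) (Phi : set K).
Variables (hne : Phi !=set0) (hcl : tensor_closed Phi) (P : Spc K).
Hypothesis ZP : Z_ Phi P.

Let prP := spc_prime P.
Let I := prime_ideal prP.

(** Each generating step tensors the cone with an object of [Phi], which lies outside [P]; primality
    cancels it. Hence representatives of a class may be chosen freely. *)
Lemma cone_in_pair_equiv (F G : balanced_pair Phi) : pair_equiv hcl F G ->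
  cone_in (spc_set P) (pair_mor F) <-> cone_in (spc_set P) (pair_mor G).
Proof.
elim=> [{}F {}G [A hA H|A hA H]|//|? ? _ h|? ? ? _ h1 _ h2];
  [| |by rewrite h|by rewrite h1].
  have [C fC] := has_cone (pair_mor H).
  rewrite (cone_inE I fC) (cone_inE I (is_cone_tensl A fC)).
  by split=> [|/(prime_tens prP)[/(ZP hA)|]//]; exact: ideal_tens I A C.
have [C fC] := has_cone (pair_mor H).
rewrite (cone_inE I fC) (cone_inE I (is_cone_tensr A fC)).
split=> [PC|/(prime_tens prP)[|/(ZP hA)]//].
by apply: ideal_tensC => //; exact: ideal_tens.
Qed.

Lemma rho_setE (F : balanced_pair Phi) :
  rho_set hne hcl P (pair_class hne hcl F) <->
  ~ cone_in (spc_set P) (pair_mor F).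
Proof.
split=> [[G [C [/pair_classP FG GC nPC]]]|nF].
  by rewrite (cone_in_pair_equiv FG) (cone_inE I GC).
have [C fC] := has_cone (pair_mor F).
by exists F, C; split => // PC; apply: nF; exists C.
Qed.

Lemma notin_tens A B : ~ spc_set P A -> ~ spc_set P B -> ~ spc_set P (A ⊗ B).
Proof. by move=> nA nB /(prime_tens prP)[]. Qed.

(* On [C ⊗ X], [f] commutes with [g] and squares to 0, so [g f] is nilpotent. *)
Lemma cone_in_compr X (f g : hom X X) : Phi X -> balanced f -> balanced g ->
  cone_in (spc_set P) (g ∘ f) -> cone_in (spc_set P) f.
Proof.
move=> hX bf bg Pgf; have [C fC] := has_cone f.
apply/(cone_inE I fC); apply: contrapT => nPC; have nPX := ZP hX.
pose W := C ⊗ X.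
(* A contradiction: [C] and [X] lie outside the prime [P], hence so does this product. *)
suff : spc_set P (W ⊗ X) by apply: notin_tens => //; exact: notin_tens.
apply: (ideal_nilpotent (n := 2) I _ Pgf); rewrite tensMr.
apply: comp_nilpotent; rewrite -!tensMr.
  exact/tens_eq_tensl/balanced_comm.
rewrite -[RHS](tens0r X X W); apply: tens_eq_tensr.
by rewrite (balanced_cone_sq bf fC) tens0r.
Qed.

(* On [(C ⊗ D) ⊗ X], [f] and [g] commute and square to 0. *)
Lemma cone_in_add X (f g : hom X X) : Phi X -> balanced f -> balanced g ->
  cone_in (spc_set P) (f + g) ->
  cone_in (spc_set P) f \/ cone_in (spc_set P) g.
Proof.
move=> hX bf bg Pfg; have [C fC] := has_cone f; have [D gD] := has_cone g.
rewrite (cone_inE I fC) (cone_inE I gD).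
apply: contrapT => /not_orP[nPC nPD]; have nPX := ZP hX.
pose W := (C ⊗ D) ⊗ X.
suff : spc_set P (W ⊗ X) by do ![apply: notin_tens => //].
apply: (ideal_nilpotent (n := 3) I _ Pfg); rewrite (tensmDr (tt_compat K)).
apply: add_nilpotent; rewrite -!tensMr.
- exact/tens_eq_tensl/balanced_comm.
- rewrite -[RHS](tens0r X X W); apply/tens_eq_tensr/tens_eq_tensr.
  by rewrite (balanced_cone_sq bf fC) tens0r.
- rewrite -[RHS](tens0r X X W); apply/tens_eq_tensr/tens_eq_tensl.
  by rewrite (balanced_cone_sq bg gD) tens0r.
Qed.

Lemma rho_set_prime : prime_ring_ideal (rho_set hne hcl P).
Proof.
split.
- by apply/rho_setE => /(cone_in0 I); exact: ZP (some_mem hne).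
(* [common_repr] takes three elements; 0 fills the spare slot. *)
- move=> x y; have [X [hX [f [g [_ [bf [bg [_ [-> -> _]]]]]]]]] :=
    common_repr x y 0.
  rewrite -[_ + _]/(R_add _ _) R_addD !rho_setE => nf ng.
  by move=> /(cone_in_add hX bf bg)[].
- move=> x y; have [X [hX [g [f [_ [bg [bf [_ [-> -> _]]]]]]]]] :=
    common_repr x y 0.
  rewrite -[_ * _]/(R_mul _ _) R_mulM !rho_setE => nf.
  by move=> /(cone_in_compr hX bf bg).
- by apply/rho_setE; apply; exact: cone_in_id.
- move=> x y; have [X [hX [f [g [_ [bf [bg [_ [-> -> _]]]]]]]]] :=
    common_repr x y 0.
  rewrite -[_ * _]/(R_mul _ _) R_mulM !rho_setE => nfg.
  by apply/not_andP => -[Pf Pg]; apply: nfg; exact: cone_in_comp.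
Qed.

End RhoPrime.

(** * Existence of primes *)

Section ExistsPrime.
Variable K : tt_category.
Implicit Types (P J S : set K) (A B C X : K).

Lemma thick_bigcap (F : set (set K)) :
  (forall P, F P -> thick_tensor_ideal P) ->
  thick_tensor_ideal (\bigcap_(P in F) P).
Proof.
move=> IF; split.
- by move=> Z Z0 P /IF I; exact: ideal_zero I _ Z0.
- by move=> X; split=> PX P FP; apply/(ideal_sus (IF _ FP)); exact: PX.
- move=> X Y f C fC PX PY P FP.
  exact (ideal_cone (IF _ FP) fC (PX _ FP) (PY _ FP)).
- move=> A B C ABC PC; split=> P FP;
    by have [] := ideal_summand (IF _ FP) ABC (PC _ FP).
- by move=> A X PX P FP; apply: ideal_tens (IF _ FP) _ _ (PX _ FP).
Qed.

Lemma zero_tens A Z : is_zero_object Z -> is_zero_object (A ⊗ Z).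
Proof.
move=> Z0; have e : idm (A ⊗ Z) = 0 by rewrite -tensm1 (Z0.1 _ (idm Z)) tens0r.
split=> X f; first by rewrite -[f]comp1m e comp0m.
by rewrite -[f]compm1 e compm0.
Qed.

Lemma biproduct_tens A X Y C : is_biproduct X Y C ->
  is_biproduct (A ⊗ X) (A ⊗ Y) (A ⊗ C).
Proof.
move=> [i1 [i2 [p1 [p2 [e1 e2 e12 e21 e]]]]].
exists (idm A ⊗m i1), (idm A ⊗m i2), (idm A ⊗m p1), (idm A ⊗m p2).
by rewrite -!tensMr -(tensmDr (tt_compat K)) e1 e2 e12 e21 e !tens0r !tensm1.
Qed.

(** The colon ideal [(P : B)] serves to exchange one tensor factor at a time in [exists_prime]. *)
Lemma thick_colon P B : thick_tensor_ideal P ->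
  thick_tensor_ideal [set X | P (B ⊗ X)].
Proof.
move=> I; split=> /=.
- by move=> Z /(zero_tens B); exact: ideal_zero.
- move=> X; rewrite -(ideal_sus I (B ⊗ X)).
  have [g [h1 h2]] := susr_iso (tt_compat K) B X.
  by split; apply: ideal_iso I _; [exists (susr (tt_compat K) B X)|exists g];
    [exists g|exists (susr (tt_compat K) B X)].
- by move=> X Y f C /(is_cone_tensl B); exact: ideal_cone.
- by move=> A A' C /(biproduct_tens B); exact: ideal_summand.
- move=> A X /(ideal_tensC I)/(ideal_tens I A)/(ideal_assocV I).
  exact: ideal_tensC.
Qed.

(** Zorn's lemma also asks about the empty chain, whose union is empty and no ideal; adjoining [J]
    repairs this. *)
Lemma thick_chain_bigcup J (F : set (set K)) : thick_tensor_ideal J ->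
  (forall P, F P -> thick_tensor_ideal (J `|` P)) -> total_on F subset ->
  thick_tensor_ideal (J `|` \bigcup_(P in F) P).
Proof.
move=> IJ IF Ft.
pose G := [set Q | Q = J \/ exists2 P, F P & Q = J `|` P].
have IG Q : G Q -> thick_tensor_ideal Q by move=> [->|[P FP ->]]; last exact: IF.
have -> : J `|` \bigcup_(P in F) P = \bigcup_(Q in G) Q.
  apply/seteqP; split=> X.
    case=> [JX|[P FP PX]]; first by exists J => //; left.
    by exists (J `|` P); [right; exists P|right].
  by move=> [Q [->|[P FP ->]]]; [left|case=> [JX|PX]; [left|right; exists P]].
have Gt : total_on G subset.
  move=> Q Q' [->|[P FP ->]] [->|[P' FP' ->]];
    [by left|by left; left|by right; left|].
  by case: (Ft _ _ FP FP') => h; [left|right]; exact: setUS.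
have G0 : G J by left.
split.
- by move=> Z Z0; exists J => //; exact: ideal_zero IJ _ Z0.
- by move=> X; split=> -[Q GQ QX]; exists Q => //;
    exact/(ideal_sus (IG _ GQ)).
- move=> X Y f C fC [Q GQ QX] [Q' GQ' QY].
  case: (Gt _ _ GQ GQ') => h.
    by exists Q' => //; exact (ideal_cone (IG _ GQ') fC (h _ QX) QY).
  by exists Q => //; exact (ideal_cone (IG _ GQ) fC QX (h _ QY)).
- move=> A B C ABC [Q GQ QC].
  by have [QA QB] := ideal_summand (IG _ GQ) ABC QC; split; exists Q.
- by move=> A X [Q GQ QX]; exists Q => //; exact: ideal_tens (IG _ GQ) _ _ QX.
Qed.

(** A thick ideal maximal among those containing [J] and missing [S] is prime. *)
Lemma exists_prime J S : thick_tensor_ideal J -> tensor_closed S ->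
  S !=set0 -> J `&` S = set0 ->
  exists P : Spc K, J `<=` spc_set P /\ spc_set P `&` S = set0.
Proof.
move=> IJ Scl [s0 Ss0] JS.
pose Q P := thick_tensor_ideal (J `|` P) /\ (J `|` P) `&` S = set0.
have [F FQ Ft|A [[IA AS] maxA]] := @Zorn_bigcup K Q.
  split; first by apply: thick_chain_bigcup => // P /FQ[].
  rewrite -subset0 => X [[JX|[P FP PX]] SX]; first by rewrite -JS.
  by have [_ <-] := FQ _ FP; split=> //; right.
set M := J `|` A in IA AS.
(* By maximality, the thick ideal generated by [M] and [X] meets [S]. *)
have hM X : ~ M X -> exists2 s, S s &
    forall P, thick_tensor_ideal P -> M `<=` P -> P X -> P s.
  move=> nMX; apply: contrapT => h.
  pose B := \bigcap_(P in [set P | [/\ thick_tensor_ideal P, M `<=` P & P X]]) P.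
  have IB : thick_tensor_ideal B by apply: thick_bigcap => P [].
  have MB : M `<=` B by move=> Y MY P [_ MP _]; exact: MP.
  have JB : J `|` B = B by apply/setUidPr => Y JY; apply: MB; left.
  apply: (maxA B).
    split; first by move=> Y AY; apply: MB; right.
    by move=> BA; apply: nMX; right; apply: BA => P [].
  split; rewrite JB // -subset0 => s [Bs Ss]; apply: h.
  by exists s => // P IP MP PX; apply: Bs.
suff pM : prime_tensor_ideal M.
  by exists (MkSpc pM); split => //= X JX; left.
split=> //.
  by exists s0 => Ms0; have : (M `&` S) s0 by []; rewrite AS.
move=> X Y MXY; apply: contrapT => /not_orP[/hM[s Ss hs] /hM[t St ht]].
(* From [X ⊗ Y] in [M], first [X] is exchanged for [s] through [(M : Y)], then [Y] for [t] through
   [(M : s)]. *)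
have MsY : M (s ⊗ Y).
  apply: (ideal_tensC IA); apply: (hs _ (thick_colon Y IA)) => [Z MZ|] /=.
    exact: ideal_tens.
  exact: ideal_tensC.
have Mst : M (s ⊗ t).
  by apply: (ht _ (thick_colon s IA)) => // Z MZ; exact: ideal_tens.
suff : (M `&` S) (s ⊗ t) by rewrite AS.
by split => //; exact: Scl.
Qed.

End ExistsPrime.

(** * Quasi-compactness *)

Lemma Z_compact (K : tt_category) (Phi : set K) (C : K) :
  Phi !=set0 -> tensor_closed Phi ->
  cover_compact [set P : Z_ Phi | spc_set (set_val P) C].
Proof.
move=> hne hcl I D f fo fcov.
(* The objects whose presence in a prime is covered by finitely many [f i]:
   by primality they are closed under ⊗, and it suffices to find one in the
   ideal generated by [C]. *)
pose S := [set s |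
  finite_subset_cover D f [set P : Z_ Phi | spc_set (set_val P) s]].
pose J := \bigcap_(P in [set P | thick_tensor_ideal P /\ P C]) P.
have [[s [Js [D' D'D sD']]]|/set0P/negP/negPn/eqP JS] := pselect (J `&` S !=set0).
  exists D' => // P PC; apply: sD'; apply: Js; split=> //.
  exact: prime_ideal (spc_prime _).
(* No prime in [Z_ Phi] contains an object of [Phi], so the empty subcover suffices. *)
have PhiS : Phi `<=` S.
  move=> X PX; exists fset0 => // -[P ZP] /=.
  by move=> PX'; case: (set_mem ZP X PX PX').
have Scl : tensor_closed S.
  move=> s t [D1 D1D h1] [D2 D2D h2]; exists (D1 `|` D2)%fset.
    by move=> i; rewrite in_fsetU => /orP[/D1D|/D2D].
  move=> P /(prime_tens (spc_prime _))[/h1|/h2] [i iD fi]; exists i => //=;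
    by rewrite in_fsetU iD ?orbT.
have IJ : thick_tensor_ideal J by apply: thick_bigcap => P [].
have [P [JP PS]] := exists_prime IJ Scl (subset_nonempty PhiS hne) JS.
have ZP : Z_ Phi P.
  move=> X /PhiS SX PX; have : (spc_set P `&` S) X by [].
  by rewrite PS.
pose P' : Z_ Phi := exist _ P (mem_set ZP).
have [|i Di fi] := fcov P'; first by apply: JP => Q [].
(* A basic neighbourhood of [P] inside [f i] consists of the primes containing some [a] in [P]; the
   single set [f i] covers it, so [a] lies in [S]. *)
have [V [A VA] fV] := fo _ Di.
have : V P by rewrite -fV in fi.
move=> VP; have : ~ (~` V) P by apply.
rewrite VA => /existsNP[a /not_implyP[Aa /contrapT Pa]].
suff : (spc_set P `&` S) a by rewrite PS.
split => //; exists [fset i]%fset => [j|Q Qa].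
  by rewrite in_fset1 => /eqP ->; exact/mem_set.
exists i; first by rewrite /= in_fset1.
rewrite -fV /=; apply: contrapT => nV.
have : (~` V) (set_val Q) by [].
by rewrite VA => /(_ _ Aa).
Qed.

Lemma cover_compact_cover (T : topologicalType) (I : choiceType)
    (D : {fset I}) (F : I -> set T) :
  (forall i, i \in D -> cover_compact (F i)) -> cover_compact (cover [set` D] F).
Proof.
move=> cF J E g go gcov.
(* The condition [i \in D] sits under the existential so that [d] is total, with default [fset0]. *)
have /choice[d dP] : forall i, exists Ei : {fset J}, i \in D ->
    {subset Ei <= E} /\ F i `<=` cover [set` Ei] g.
  move=> i; have [iD|_] := boolP (i \in D); last by exists fset0.
  have [|Ei EiE iEi] := cF i iD J E g go; last by exists Ei.
  by move=> x Fx; apply: gcov; exists i.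
exists (\bigcup_(i <- D) d i)%fset.
  move=> j /bigfcupP[i]; rewrite andbT => iD; exact: (dP i iD).1.
move=> x [i /= iD /(dP i iD).2[j jd gj]]; exists j => //=.
by apply/bigfcupP; exists i => //; rewrite iD.
Qed.

(** * Continuity and spectrality of the comparison map *)

Section Rho.
Variables (K : tt_category) (Phi : set K).
Variables (hne : Phi !=set0) (hcl : tensor_closed Phi).

Definition rho (P : Z_ Phi) : Spec (R_ hne hcl) :=
  MkSpec (rho_set_prime hne hcl (set_mem (valP P))).

(** The preimage of the closed set [V(I)] is the trace on [Z_ Phi] of the intersection of the
    supports of all cones of representatives of elements of [I]. *)
Lemma rho_continuous : continuous rho.
Proof.
apply/continuousP => U [I UI].
pose A := [set C | exists2 F : balanced_pair Phi,
  I (pair_class hne hcl F) & is_cone (pair_mor F) C].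
exists (~` \bigcap_(C in A) (supp C)); first by exists A; rewrite setCK.
apply/seteqP; split=> P /=.
  apply: contra_notP => nU C [F IF FC].
  have : (~` U) (rho P) by [].
  rewrite UI => /(_ _ IF) /(rho_setE _ _ (set_mem (valP P))).
  by apply: contra_not => PC; exists C.
apply: contraPnot => AP.
have : (~` U) (rho P); last by [].
rewrite UI => r /=; rewrite -[r]pair_reprK => Ir.
have [C FC] := has_cone (pair_mor (pair_repr r)).
exists (pair_repr r), C; split=> //.
by apply: AP; exists (pair_repr r).
Qed.

(** A quasi-compact [U] is a finite union of basic open sets [D(r)], and [Z_compact] handles the
    preimage of each. *)
Lemma rho_spectral : spectral_map rho.
Proof.
split; first exact: rho_continuous.
move=> U [I UI] cU.
pose f (r : R_ hne hcl) : set (Spec (R_ hne hcl)) := [set p | ~ spec_set p r].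
have [||D DI Uf] := cU _ I f.
- move=> r _; exists [set r]; apply/seteqP; split=> p /=.
    by rewrite /f /= => /contrapT pr _ ->.
  by move=> h; apply; exact: h.
- move=> p Up; apply: contrapT => np; have : (~` U) p; last by [].
  by rewrite UI => r Ir; apply: contrapT => pr; apply: np; exists r.
have cone_ex r := cid (has_cone (pair_mor (pair_repr (r : R_ hne hcl)))).
pose c r := sval (cone_ex r).
have rhoE r (P : Z_ Phi) :
    spec_set (rho P) r <-> ~ spc_set (set_val P) (c r).
  have := rho_setE hne hcl (set_mem (valP P)) (pair_repr r).
  rewrite pair_reprK (cone_inE (prime_ideal (spc_prime _)) (svalP (cone_ex r))).
  exact.
have -> : rho @^-1` U =
    cover [set` D] (fun r => [set P : Z_ Phi | spc_set (set_val P) (c r)]).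
  apply/seteqP; split=> P.
    move=> /Uf[r rD nr]; exists r => //.
    by apply: contrapT => /(rhoE r P).2.
  move=> [r rD Pc] /=; apply: contrapT => nU.
  have : (~` U) (rho P) by [].
  by rewrite UI => /(_ r (set_mem (DI _ rD))) /rhoE.
by apply: cover_compact_cover => r _; exact: Z_compact.
Qed.

End Rho.

Theorem theorem4p12 (K : tt_category) (hK : essentially_small K)
    (Phi : set K) (hne : Phi !=set0) (hcl : tensor_closed Phi) :
  exists rho : Z_ Phi -> Spec (R_ hne hcl),
    [/\ forall P : Z_ Phi, spec_set (rho P) = rho_set hne hcl (set_val P),
        forall P Q : Z_ Phi,
          spc_set (set_val P) `<=` spc_set (set_val Q) ->
          spec_set (rho Q) `<=` spec_set (rho P)
      & spectral_map rho].
Proof.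
exists (@rho K Phi hne hcl); split=> //; last exact: rho_spectral.
by move=> P Q PQ r [F [C [rF FC nQ]]]; exists F, C; split=> // /PQ.
Qed.
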